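(* Let $k$ be a commutative ring and let $\mathcal C=\bigoplus_{n\ge 0}\mathcal C(n)$ be a planar counital cooperad in $k$-modules with partial decompositions $\Delta_{p,q,i}$. Define the cobrace $[-]\colon\mathcal C\to\mathcal C\otimes\mathcal C$ on $x\in\mathcal C(n)$ by $$[x]=\sum_{p=1}^{n+1}\sum_{i=1}^{p}(-1)^{(n-p)(p-i)}\,\Delta_{p,\,n+1-p,\,i}(x)\ \in\bigoplus_{p+q=n+1}\mathcal C(p)\otimes\mathcal C(q).$$ Then $[-]$ satisfies the pre-coJacobi identity $$\big([-]\otimes\mathrm{id}-\mathrm{id}\otimes[-]\big)\circ[-]=(\mathrm{id}\otimes\rho)\circ\big([-]\otimes\mathrm{id}-\mathrm{id}\otimes[-]\big)\circ[-],$$ where $\rho(a\otimes b)=(-1)^{(p-1)(q-1)}\,b\otimes a$ for $a\in\mathcal C(p)$, $b\in\mathcal C(q)$.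
   Context: Tensor products are over $k$. A planar counital cooperad is a sequence $\mathcal C=\{\mathcal C(n)\}_{n\ge0}$ of $k$-modules with $k$-linear maps $\epsilon\colon\mathcal C(1)\to k$ and $\Delta_{p,q,i}\colon\mathcal C(p+q-1)\to\mathcal C(p)\otimes\mathcal C(q)$ for $p\ge1$, $q\ge0$, $1\le i\le p$ (and $\Delta_{0,q,i}:=0$), such that $(\epsilon\otimes\mathrm{id})\circ\Delta_{1,n,1}=\mathrm{id}_{\mathcal C(n)}$, $(\mathrm{id}\otimes\epsilon)\circ\Delta_{n,1,i}=\mathrm{id}_{\mathcal C(n)}$ for $1\le i\le n$, and for all $p\ge 1$, $q,r\ge0$, $1\le i\le p$, $1\le j\le p+q-1$: $$(\Delta_{p,q,i}\otimes\mathrm{id})\circ\Delta_{p+q-1,r,j}=\begin{cases}(\mathrm{id}\otimes\sigma)\circ(\Delta_{p,r,j-q+1}\otimes\mathrm{id})\circ\Delta_{p+r-1,q,i}& i\le j-q,\\(\mathrm{id}\otimes\Delta_{q,r,j-i+1})\circ\Delta_{p,q+r-1,i}& j-q<i\le j,\\(\mathrm{id}\otimes\sigma)\circ(\Delta_{p,r,j}\otimes\mathrm{id})\circ\Delta_{p+r-1,q,i+r-1}& j<i\le p,\end{cases}$$ where $\sigma(a\otimes b)=b\otimes a$. The maps $[-]\otimes\mathrm{id}$ and $\mathrm{id}\otimes[-]$ are applied without additional signs. *)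

(* Defs.v *)
From HB Require Import structures.
From mathcomp Require Import all_boot all_order all_algebra.
From mathcomp Require Import boolp.

Set Implicit Arguments.
Unset Strict Implicit.
Unset Printing Implicit Defensive.

Import GRing.Theory.
Local Open Scope ring_scope.
Local Open Scope quotient_scope.

(** An element of [tens M N] is a class of finite formal sums of pairs
    [m_1 (x) n_1 + ... + m_l (x) n_l], encoded as a list of pairs, for the
    congruence generated by the bilinearity relations.  Scalars need not appear
    in formal sums, as they can be absorbed in the left factors.  The universal
    property is given by [tlift_linear], [tlift_pure] and [tens_ext]. *)

Section TensorProduct.
Variables (k : comPzRingType) (M N : lmodType k).
Implicit Types (s t u : seq (M * N)) (m : M) (n : N) (a : k).

Inductive tens_eqv : seq (M * N) -> seq (M * N) -> Prop :=
| tens_eqv_refl s : tens_eqv s s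
| tens_eqv_sym s t : tens_eqv s t -> tens_eqv t s
| tens_eqv_trans s t u : tens_eqv s t -> tens_eqv t u -> tens_eqv s u
| tens_eqv_cat s s' t t' :
    tens_eqv s s' -> tens_eqv t t' -> tens_eqv (s ++ t) (s' ++ t')
| tens_eqv_catC s t : tens_eqv (s ++ t) (t ++ s)
| tens_eqv_Dl m m' n : tens_eqv [:: (m + m', n)] [:: (m, n); (m', n)]
| tens_eqv_Dr m n n' : tens_eqv [:: (m, n + n')] [:: (m, n); (m, n')]
| tens_eqv_Z a m n : tens_eqv [:: (a *: m, n)] [:: (m, a *: n)]
| tens_eqv_0 n : tens_eqv [:: (0, n)] [::].

Definition tens_rel : rel (seq (M * N)) := fun s t => `[< tens_eqv s t >].

Lemma tens_rel_refl : reflexive tens_rel.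
Proof. by move=> s; apply/asboolP; constructor. Qed.

Lemma tens_rel_sym : symmetric tens_rel.
Proof.
by move=> s t; apply/asboolP/asboolP => h; exact: tens_eqv_sym.
Qed.

Lemma tens_rel_trans : transitive tens_rel.
Proof.
move=> t s u /asboolP hst /asboolP htu; apply/asboolP.
exact: tens_eqv_trans htu.
Qed.

Canonical tens_equiv : equiv_rel (seq (M * N)) :=
  EquivRel tens_rel tens_rel_refl tens_rel_sym tens_rel_trans.

Definition tens : Type := {eq_quot tens_equiv}.

HB.instance Definition _ := Choice.on tens.
HB.instance Definition _ := EqQuotient.on tens.

Lemma tens_piP s t : \pi_tens s = \pi_tens t <-> tens_eqv s t.
Proof. by split=> [/eqmodP/asboolP // | h]; apply/eqmodP/asboolP. Qed.

Lemma tens_repr s : tens_eqv (repr (\pi_tens s)) s.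
Proof. by apply/tens_piP; rewrite reprK. Qed.

Definition scale_fs a s : seq (M * N) := [seq (a *: mn.1, mn.2) | mn <- s].

Lemma scale_fs_cat a s t : scale_fs a (s ++ t) = scale_fs a s ++ scale_fs a t.
Proof. exact: map_cat. Qed.

Lemma scale_fs_eqv a s t : tens_eqv s t -> tens_eqv (scale_fs a s) (scale_fs a t).
Proof.
elim=> {s t} [s|s t _|s t u _ + _|s s' t t' _ hs _ ht|s t|m m' n|m n n'|b m n|n].
- exact: tens_eqv_refl.
- exact: tens_eqv_sym.
- exact: tens_eqv_trans.
- by rewrite !scale_fs_cat; constructor.
- by rewrite !scale_fs_cat; constructor.
- by rewrite /= scalerDr; constructor.
- by constructor.
- by rewrite /= scalerA mulrC -scalerA; constructor.
- by rewrite /= scaler0; constructor.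
Qed.

Definition tens_zero : tens := \pi_tens [::].
Definition tens_add (x y : tens) : tens := \pi_tens (repr x ++ repr y).
Definition tens_scale a (x : tens) : tens := \pi_tens (scale_fs a (repr x)).
Definition tens_opp (x : tens) : tens := tens_scale (-1) x.

Lemma tens_addE s t : tens_add (\pi_tens s) (\pi_tens t) = \pi_tens (s ++ t).
Proof. by apply/tens_piP; constructor; exact: tens_repr. Qed.

Lemma tens_scaleE a s : tens_scale a (\pi_tens s) = \pi_tens (scale_fs a s).
Proof. by apply/tens_piP/scale_fs_eqv; exact: tens_repr. Qed.

Lemma tens_addA : associative tens_add.
Proof.
elim/quotW=> s; elim/quotW=> t; elim/quotW=> u.
by rewrite (tens_addE t u) (tens_addE s t) !tens_addE catA.
Qed.

Lemma tens_addC : commutative tens_add.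
Proof. by move=> x y; apply/tens_piP; constructor. Qed.

Lemma tens_add0 : left_id tens_zero tens_add.
Proof. by elim/quotW=> s; rewrite /tens_zero tens_addE. Qed.

Lemma tens_addN : left_inverse tens_zero tens_opp tens_add.
Proof.
elim/quotW=> u; rewrite /tens_opp tens_scaleE tens_addE.
apply/tens_piP; elim: u => [|[m n] s ih] /=; first by constructor.
rewrite -cat1s; apply: (@tens_eqv_trans _
  ([:: (-1 *: m, n)] ++ ([:: (m, n)] ++ (s ++ scale_fs (-1) s)))).
  apply: tens_eqv_cat; first by constructor.
  apply: tens_eqv_trans (tens_eqv_catC _ _) _.
  by rewrite -cat1s -catA; constructor.
have h : tens_eqv [:: (-1 *: m, n); (m, n)] [::].
  apply: (@tens_eqv_trans _ [:: (-1 *: m + m, n)]).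
    by apply: tens_eqv_sym; exact: tens_eqv_Dl.
  by rewrite scaleN1r addNr; constructor.
by rewrite catA; apply: (tens_eqv_cat h); exact: tens_eqv_trans (tens_eqv_catC _ _) ih.
Qed.

HB.instance Definition _ :=
  GRing.isZmodule.Build tens tens_addA tens_addC tens_add0 tens_addN.

Lemma tens_scaleA a b (x : tens) :
  tens_scale a (tens_scale b x) = tens_scale (a * b) x.
Proof.
elim/quotW: x => s; rewrite (tens_scaleE b s) !tens_scaleE /scale_fs -map_comp.
by congr (\pi_tens _); apply: eq_map => mn /=; rewrite scalerA.
Qed.

Lemma tens_scale1 : left_id 1 tens_scale.
Proof.
elim/quotW=> s; rewrite tens_scaleE; congr (\pi_tens _).
by rewrite /scale_fs -[RHS]map_id; apply: eq_map => -[m n] /=; rewrite scale1r.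
Qed.

Lemma tens_scaleDr : right_distributive tens_scale +%R.
Proof.
move=> a; elim/quotW=> s; elim/quotW=> t.
rewrite -[RHS]/(tens_add _ _) (tens_scaleE a s) (tens_scaleE a t) tens_addE.
by rewrite [X in tens_scale _ X]tens_addE tens_scaleE scale_fs_cat.
Qed.

Lemma tens_scaleDl (x : tens) : {morph tens_scale^~ x : a b / a + b}.
Proof.
move=> a b; elim/quotW: x => s; rewrite /= !tens_scaleE.
rewrite -[RHS]/(tens_add _ _) tens_addE; apply/tens_piP.
elim: s => [|[m n] s ih] /=; first by constructor.
rewrite scalerDl -cat1s.
apply: tens_eqv_trans (tens_eqv_cat (tens_eqv_Dl _ _ _) ih) _ => /=.
rewrite -cat1s -[X in tens_eqv _ X]cat1s.
apply: tens_eqv_cat; first by constructor.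
rewrite -cat1s -[X in tens_eqv _ (_ ++ X)]cat1s !catA.
by apply: tens_eqv_cat; constructor.
Qed.

HB.instance Definition _ := GRing.Zmodule_isLmodule.Build k tens
  tens_scaleA tens_scale1 tens_scaleDr tens_scaleDl.

Definition tpure m n : tens := \pi_tens [:: (m, n)].

Lemma tpureDl m m' n : tpure (m + m') n = tpure m n + tpure m' n.
Proof. by rewrite -[RHS]/(tens_add _ _) tens_addE; apply/tens_piP; constructor. Qed.

Lemma tpureDr m n n' : tpure m (n + n') = tpure m n + tpure m n'.
Proof. by rewrite -[RHS]/(tens_add _ _) tens_addE; apply/tens_piP; constructor. Qed.

Lemma tpureZl a m n : tpure (a *: m) n = a *: tpure m n.
Proof. by rewrite -[RHS]/(tens_scale _ _) tens_scaleE. Qed.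

Lemma tpureZr a m n : tpure m (a *: n) = a *: tpure m n.
Proof. by rewrite -tpureZl; apply/tens_piP; apply: tens_eqv_sym; constructor. Qed.

Lemma tens_sum (x : tens) : x = \sum_(mn <- repr x) tpure mn.1 mn.2.
Proof.
rewrite -[LHS]reprK; elim: (repr x) => [|[m n] s ih]; first by rewrite big_nil.
by rewrite big_cons /= -ih -[RHS]/(tens_add _ _) tens_addE.
Qed.

Section Lift.
Variable P : lmodType k.

Definition bilinear_map (f : M -> N -> P) : Prop :=
  (forall n, linear (fun m => f m n)) /\ (forall m, linear (f m)).

(* Only meaningful when [f] is bilinear. *)
Definition tlift (f : M -> N -> P) (x : tens) : P :=
  \sum_(mn <- repr x) f mn.1 mn.2.

Variable f : M -> N -> P.
Hypothesis f_bil : bilinear_map f.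

Lemma bilinear_mapDl m m' n : f (m + m') n = f m n + f m' n.
Proof. by have /= := f_bil.1 n 1 m m'; rewrite !scale1r. Qed.

Lemma bilinear_mapDr m n n' : f m (n + n') = f m n + f m n'.
Proof. by have /= := f_bil.2 m 1 n n'; rewrite !scale1r. Qed.

Lemma bilinear_map0l n : f 0 n = 0.
Proof. by apply: (addrI (f 0 n)); rewrite -bilinear_mapDl !addr0. Qed.

Lemma bilinear_map0r m : f m 0 = 0.
Proof. by apply: (addrI (f m 0)); rewrite -bilinear_mapDr !addr0. Qed.

Lemma bilinear_mapZl a m n : f (a *: m) n = a *: f m n.
Proof. by have /= := f_bil.1 n a m 0; rewrite !addr0 bilinear_map0l addr0. Qed.

Lemma bilinear_mapZr a m n : f m (a *: n) = a *: f m n.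
Proof. by have /= := f_bil.2 m a n 0; rewrite !addr0 bilinear_map0r addr0. Qed.

Lemma tlift_pi s : tlift f (\pi_tens s) = \sum_(mn <- s) f mn.1 mn.2.
Proof.
rewrite /tlift; have := tens_repr s; move: (repr _) => t; elim=> {s t} //=.
- by move=> s t u _ -> _ ->.
- by move=> s s' t t' _ hs _ ht; rewrite !big_cat /= hs ht.
- by move=> s t; rewrite !big_cat /= addrC.
- by move=> m m' n; rewrite !big_cons !big_nil /= !addr0 bilinear_mapDl.
- by move=> m n n'; rewrite !big_cons !big_nil /= !addr0 bilinear_mapDr.
- by move=> a m n; rewrite !big_seq1 /= bilinear_mapZl bilinear_mapZr.
- by move=> n; rewrite big_seq1 big_nil /= bilinear_map0l.
Qed.

Lemma tlift_pure m n : tlift f (tpure m n) = f m n.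
Proof. by rewrite tlift_pi big_seq1. Qed.

Lemma tlift_linear : linear (tlift f).
Proof.
move=> a; elim/quotW=> s; elim/quotW=> t.
rewrite [_ *: _](tens_scaleE a s) [_ + _]tens_addE !tlift_pi big_cat big_map /=.
by rewrite scaler_sumr; congr (_ + _); apply: eq_bigr => mn _; rewrite bilinear_mapZl.
Qed.

End Lift.

Lemma tens_ext (P : lmodType k) (f g : {linear tens -> P}) :
  (forall m n, f (tpure m n) = g (tpure m n)) -> f =1 g.
Proof.
move=> fg x; rewrite [x]tens_sum !raddf_sum.
by apply: eq_bigr => mn _; exact: fg.
Qed.

End TensorProduct.

Arguments tens {k} M N.
Arguments tpure {k M N} m n.

Notation "M \ox N" := (tens M N) (at level 40, left associativity) : type_scope.

Section TensorMaps.
Variable k : comPzRingType.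
Implicit Types M N P : lmodType k.

(* Meaningful when [f] and [g] are linear. *)
Definition tmap M M' N N' (f : M -> M') (g : N -> N') : M \ox N -> M' \ox N' :=
  tlift (fun m n => tpure (f m) (g n)).

Section Map.
Variables (M M' N N' : lmodType k).
Variables (f : {linear M -> M'}) (g : {linear N -> N'}).

Lemma tmap_bilinear : bilinear_map (fun m n => tpure (f m) (g n)).
Proof.
split=> [n a m m'|m a n n']; rewrite linearP.
  by rewrite tpureDl tpureZl.
by rewrite tpureDr tpureZr.
Qed.

Lemma tmap_pure m n : tmap f g (tpure m n) = tpure (f m) (g n).
Proof. exact: tlift_pure tmap_bilinear _ _. Qed.

HB.instance Definition _ :=
  GRing.isLinear.Build k _ _ _ (tmap f g) (tlift_linear tmap_bilinear).
End Map.

Definition tswap M N : M \ox N -> N \ox M := tlift (fun m n => tpure n m).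

Section Swap.
Variables (M N : lmodType k).

Lemma tswap_bilinear : bilinear_map (fun (m : M) (n : N) => tpure n m).
Proof.
by split=> [n a m m'|m a n n']; rewrite ?tpureDl ?tpureDr ?tpureZl ?tpureZr.
Qed.

Lemma tswap_pure m n : tswap (tpure m n) = tpure n m :> N \ox M.
Proof. exact: tlift_pure tswap_bilinear _ _. Qed.

HB.instance Definition _ :=
  GRing.isLinear.Build k _ _ _ (@tswap M N) (tlift_linear tswap_bilinear).
End Swap.

Definition tassoc M N P : (M \ox N) \ox P -> M \ox (N \ox P) :=
  tlift (fun x c => tlift (fun a b => tpure a (tpure b c)) x).

Section Assoc.
Variables (M N P : lmodType k).

Lemma tassoc_bilinear1 (c : P) :
  bilinear_map (fun (a : M) (b : N) => tpure a (tpure b c)).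
Proof.
by split=> [n a m m'|m a n n']; rewrite ?tpureDl ?tpureDr ?tpureZl ?tpureZr.
Qed.

Lemma tassoc_bilinear : bilinear_map
  (fun (x : M \ox N) (c : P) => tlift (fun a b => tpure a (tpure b c)) x).
Proof.
split=> [c|x a c c']; first exact: tlift_linear (tassoc_bilinear1 c).
rewrite /tlift scaler_sumr -big_split; apply: eq_bigr => mn _.
by rewrite /= !tpureDr !tpureZr.
Qed.

Lemma tassoc_pure (a : M) (b : N) (c : P) :
  tassoc (tpure (tpure a b) c) = tpure a (tpure b c).
Proof.
rewrite /tassoc (tlift_pure tassoc_bilinear).
exact: tlift_pure (tassoc_bilinear1 c) _ _.
Qed.

HB.instance Definition _ :=
  GRing.isLinear.Build k _ _ _ (@tassoc M N P) (tlift_linear tassoc_bilinear).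
End Assoc.

(* The canonical isomorphisms k (x) M = M and M (x) k = M. *)
Definition tunitl M : k^o \ox M -> M := tlift (fun (a : k^o) m => (a : k) *: m).
Definition tunitr M : M \ox k^o -> M := tlift (fun m (a : k^o) => (a : k) *: m).

Section Units.
Variable M : lmodType k.

Lemma tunitl_bilinear : bilinear_map (fun (a : k^o) (m : M) => (a : k) *: m).
Proof.
split=> [m a b c|b a m m']; first by rewrite scalerDl scalerA.
by rewrite scalerDr !scalerA mulrC.
Qed.

Lemma tunitr_bilinear : bilinear_map (fun (m : M) (a : k^o) => (a : k) *: m).
Proof. by case: tunitl_bilinear. Qed.

Lemma tunitl_pure (a : k^o) (m : M) : tunitl (tpure a m) = (a : k) *: m.
Proof. exact: tlift_pure tunitl_bilinear _ _. Qed.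

Lemma tunitr_pure (m : M) (a : k^o) : tunitr (tpure m a) = (a : k) *: m.
Proof. exact: tlift_pure tunitr_bilinear _ _. Qed.

HB.instance Definition _ :=
  GRing.isLinear.Build k _ _ _ (@tunitl M) (tlift_linear tunitl_bilinear).
HB.instance Definition _ :=
  GRing.isLinear.Build k _ _ _ (@tunitr M) (tlift_linear tunitr_bilinear).
End Units.

End TensorMaps.

Arguments tmap {k M M' N N'} f g _.
Arguments tswap {k M N} _.
Arguments tassoc {k M N P} _.
Arguments tunitl {k M} _.
Arguments tunitr {k M} _.

Section DirectSum.
Variables (k : comPzRingType) (C : nat -> lmodType k).

Record dsum : Type := DSum {
  dsum_fun :> forall n, C n;
  dsum_fin : exists N, forall n, (N <= n)%N -> dsum_fun n = 0
}.

HB.instance Definition _ := gen_eqMixin dsum.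
HB.instance Definition _ := gen_choiceMixin dsum.

Lemma dsumP (x y : dsum) : (forall n, x n = y n) -> x = y.
Proof.
case: x y => [x hx] [y hy] /= xy; have {xy} /= exy := functional_extensionality_dep xy.
by case: _ / exy hy => hy; congr DSum; exact: Prop_irrelevance.
Qed.

Lemma dsum_zero_fin : exists N, forall n, (N <= n)%N -> (0 : C n) = 0.
Proof. by exists 0. Qed.

Lemma dsum_add_fin (x y : dsum) :
  exists N, forall n, (N <= n)%N -> x n + y n = 0.
Proof.
have [N hN] := dsum_fin x; have [N' hN'] := dsum_fin y; exists (maxn N N') => n.
by rewrite geq_max => /andP[h h']; rewrite hN // hN' // addr0.
Qed.

Lemma dsum_opp_fin (x : dsum) : exists N, forall n, (N <= n)%N -> - x n = 0.
Proof. by have [N hN] := dsum_fin x; exists N => n h; rewrite hN // oppr0. Qed.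

Lemma dsum_scale_fin a (x : dsum) :
  exists N, forall n, (N <= n)%N -> a *: x n = 0.
Proof. by have [N hN] := dsum_fin x; exists N => n h; rewrite hN // scaler0. Qed.

Definition dsum_zero : dsum := DSum dsum_zero_fin.
Definition dsum_add (x y : dsum) : dsum := DSum (dsum_add_fin x y).
Definition dsum_opp (x : dsum) : dsum := DSum (dsum_opp_fin x).
Definition dsum_scale (a : k) (x : dsum) : dsum := DSum (dsum_scale_fin a x).

Lemma dsum_addA : associative dsum_add.
Proof. by move=> x y z; apply: dsumP => n /=; rewrite addrA. Qed.
Lemma dsum_addC : commutative dsum_add.
Proof. by move=> x y; apply: dsumP => n /=; rewrite addrC. Qed.
Lemma dsum_add0 : left_id dsum_zero dsum_add.
Proof. by move=> x; apply: dsumP => n /=; rewrite add0r. Qed.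
Lemma dsum_addN : left_inverse dsum_zero dsum_opp dsum_add.
Proof. by move=> x; apply: dsumP => n /=; rewrite addNr. Qed.

HB.instance Definition _ :=
  GRing.isZmodule.Build dsum dsum_addA dsum_addC dsum_add0 dsum_addN.

Lemma dsum_scaleA a b (x : dsum) :
  dsum_scale a (dsum_scale b x) = dsum_scale (a * b) x.
Proof. by apply: dsumP => n /=; rewrite scalerA. Qed.
Lemma dsum_scale1 : left_id 1 dsum_scale.
Proof. by move=> x; apply: dsumP => n /=; rewrite scale1r. Qed.
Lemma dsum_scaleDr : right_distributive dsum_scale +%R.
Proof. by move=> a x y; apply: dsumP => n /=; rewrite scalerDr. Qed.
Lemma dsum_scaleDl (x : dsum) : {morph dsum_scale^~ x : a b / a + b}.
Proof. by move=> a b; apply: dsumP => n /=; rewrite scalerDl. Qed.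

HB.instance Definition _ := GRing.Zmodule_isLmodule.Build k dsum
  dsum_scaleA dsum_scale1 dsum_scaleDr dsum_scaleDl.

Lemma dsumDE (x y : dsum) n : (x + y) n = x n + y n. Proof. by []. Qed.
Lemma dsumZE a (x : dsum) n : (a *: x) n = a *: x n. Proof. by []. Qed.
Lemma dsum0E n : (0 : dsum) n = 0. Proof. by []. Qed.

Definition dinj_fun n (x : C n) m : C m :=
  match @eqP _ n m with
  | ReflectT e => ecast m (C m) e x
  | ReflectF _ => 0
  end.

Lemma dinj_fun_eq n (x : C n) : dinj_fun x n = x.
Proof. by rewrite /dinj_fun; case: eqP => // e; rewrite eq_axiomK. Qed.

Lemma dinj_fun_neq n m (x : C n) : n != m -> dinj_fun x m = 0.
Proof. by rewrite /dinj_fun; case: eqP. Qed.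

Lemma dinj_fin n (x : C n) : exists N, forall m, (N <= m)%N -> dinj_fun x m = 0.
Proof. by exists n.+1 => m h; rewrite dinj_fun_neq // neq_ltn h. Qed.

Definition dinj n (x : C n) : dsum := DSum (dinj_fin x).

Lemma dinj_linear n : linear (@dinj n).
Proof.
move=> a x y; apply: dsumP => m; rewrite dsumDE dsumZE /=.
have [<-|nm] := eqVneq n m; first by rewrite !dinj_fun_eq.
by rewrite !dinj_fun_neq // scaler0 addr0.
Qed.

HB.instance Definition _ n :=
  GRing.isLinear.Build k _ _ _ (@dinj n) (@dinj_linear n).

Definition dbound (x : dsum) : nat := sval (cid (dsum_fin x)).

Lemma dboundP (x : dsum) n : (dbound x <= n)%N -> x n = 0.
Proof. exact: (svalP (cid (dsum_fin x))). Qed.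

Lemma dsum_sum (x : dsum) : x = \sum_(n < dbound x) dinj (x n).
Proof.
apply: dsumP => m.
have -> : forall B, (\sum_(n < B) dinj (x n)) m = \sum_(n < B) dinj (x n) m.
  by move=> B; elim/big_rec2: _ => // n y z _ <-.
have [h|h] := ltnP m (dbound x); last first.
  rewrite dboundP // big1 // => n _ /=; rewrite dinj_fun_neq //.
  by rewrite neq_ltn (leq_trans (ltn_ord n) h).
rewrite (bigD1 (Ordinal h)) //= dinj_fun_eq big1 ?addr0 // => n.
by move=> nh; rewrite dinj_fun_neq.
Qed.

Section Lift.
Variable V : lmodType k.

(* The map out of the direct sum given by maps [f n] on the summands;
   meaningful when the [f n] are linear. *)
Definition dlift (f : forall n, C n -> V) (x : dsum) : V :=
  \sum_(n < dbound x) f n (x n).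

Variable f : forall n, C n -> V.
Local Arguments f : clear implicits.
Hypothesis f_lin : forall n, linear (f n).

Lemma dlift_f0 n : f n 0 = 0.
Proof.
have := @f_lin n 1 0 0; rewrite !scale1r addr0 => h.
by apply: (addrI (f n 0)); rewrite -h addr0.
Qed.

Lemma dlift_widen (x : dsum) B : (forall n, (B <= n)%N -> x n = 0) ->
  dlift f x = \sum_(n < B) f n (x n).
Proof.
have aux B1 B2 : (forall n, (B1 <= n)%N -> x n = 0) -> (B1 <= B2)%N ->
    \sum_(n < B1) f n (x n) = \sum_(n < B2) f n (x n).
  move=> h le12; rewrite (big_ord_widen _ (fun n => f n (x n)) le12).
  rewrite big_mkcond /=; apply: eq_bigr => n _; case: ltnP => // /h ->.
  by rewrite dlift_f0.
move=> hB; rewrite /dlift (aux _ (maxn B (dbound x)) (@dboundP x)) ?leq_maxr //.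
by rewrite -(aux B) ?leq_maxl.
Qed.

Lemma dlift_linear : linear (dlift f).
Proof.
move=> a x y; pose B := maxn (dbound x) (dbound y).
have hx n : (B <= n)%N -> x n = 0.
  by rewrite geq_max => /andP[/dboundP].
have hy n : (B <= n)%N -> y n = 0.
  by rewrite geq_max => /andP[_ /dboundP].
rewrite (dlift_widen hx) (dlift_widen hy) (@dlift_widen _ B) => [|n h].
  rewrite scaler_sumr -big_split; apply: eq_bigr => n _.
  by rewrite dsumDE dsumZE f_lin.
by rewrite dsumDE dsumZE hx // hy // scaler0 addr0.
Qed.

Lemma dlift_inj n (x : C n) : dlift f (dinj x) = f n x.
Proof.
rewrite (@dlift_widen _ n.+1) => [|m h]; last first.
  by rewrite /= dinj_fun_neq // neq_ltn h.
rewrite big_ord_recr /= dinj_fun_eq big1 ?add0r // => m _.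
by rewrite dinj_fun_neq ?dlift_f0 // neq_ltn ltn_ord orbT.
Qed.

End Lift.

Lemma dsum_ext (V : lmodType k) (f g : {linear dsum -> V}) :
  (forall n (x : C n), f (dinj x) = g (dinj x)) -> f =1 g.
Proof.
move=> fg x; rewrite [x]dsum_sum !raddf_sum.
by apply: eq_bigr => n _; exact: fg.
Qed.

End DirectSum.

Arguments dsum {k} C.
Arguments dinj {k C} n x.

Section Cooperad.
Variable k : comPzRingType.

Local Open Scope nat_scope.

(* [cop_dec n p q i] is the partial decomposition Delta_{p,q,i} on C(n), where
   n = p + q - 1.  The arity n is a separate index so that the axioms need no
   transport along equalities of arities; the family is extended by 0 outside
   the range 1 <= i <= p, n = p + q - 1 (which covers Delta_{0,q,i} = 0). *)
Record planar_counital_cooperad := PlanarCooperad {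
  cop :> nat -> lmodType k;
  cop_counit : {linear cop 1 -> k^o};
  cop_dec : forall n p q i : nat, {linear cop n -> cop p \ox cop q};
  cop_dec_out : forall (n p q i : nat) (x : cop n),
    ~~ [&& 1 <= i, i <= p & p + q == n.+1] ->
    cop_dec n p q i x = 0%R;
  cop_counitl : forall (n : nat) (x : cop n),
    tunitl (tmap cop_counit idfun (cop_dec n 1 n 1 x)) = x;
  cop_counitr : forall (n i : nat) (x : cop n), 1 <= i <= n ->
    tunitr (tmap idfun cop_counit (cop_dec n n 1 i x)) = x;
  cop_coassoc : forall (n p q r i j : nat) (x : cop n),
    1 <= p -> 1 <= i <= p -> 1 <= j <= (p + q).-1 ->
    n = ((p + q).-1 + r).-1 ->
    tassoc (tmap (cop_dec (p + q).-1 p q i) idfun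
                 (cop_dec n (p + q).-1 r j x)) =
    if i + q <= j then
      tmap idfun tswap (tassoc
        (tmap (cop_dec (p + r).-1 p r (j - q + 1)) idfun
              (cop_dec n (p + r).-1 q i x)))
    else if i <= j then
      tmap idfun (cop_dec (q + r).-1 q r (j - i + 1))
           (cop_dec n p (q + r).-1 i x)
    else
      tmap idfun tswap (tassoc
        (tmap (cop_dec (p + r).-1 p r j) idfun
              (cop_dec n (p + r).-1 q (i + r - 1) x)))
}.

Local Close Scope nat_scope.

(* (-1)^m for an integer exponent m, possibly negative. *)
Definition isgn (m : int) : k := (-1) ^+ `|m|%N.

Variable C : planar_counital_cooperad.

Definition cobrace_hom n (x : C n) : dsum C \ox dsum C :=
  \sum_(1 <= p < n.+2) \sum_(1 <= i < p.+1)
    isgn ((n%:Z - p%:Z) * (p%:Z - i%:Z)) *: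
      tmap (dinj p) (dinj (n + 1 - p)%N) (cop_dec C n p (n + 1 - p)%N i x).

Lemma cobrace_hom_linear n : linear (@cobrace_hom n).
Proof.
move=> a x y; rewrite /cobrace_hom scaler_sumr -big_split; apply: eq_bigr => p _.
rewrite scaler_sumr -big_split; apply: eq_bigr => i _ /=.
by rewrite !linearP.
Qed.

Definition cobrace : dsum C -> dsum C \ox dsum C := dlift cobrace_hom.

HB.instance Definition _ := GRing.isLinear.Build k _ _ _ cobrace
  (dlift_linear cobrace_hom_linear).

Lemma cobraceE n (x : C n) : cobrace (dinj n x) = cobrace_hom x.
Proof. exact: dlift_inj cobrace_hom_linear _ _. Qed.

(* The signed swap, determined by its values on homogeneous pure tensors, see
   [rhoE]. *)
Definition rho_hom p q (x : C p) (y : C q) : dsum C \ox dsum C :=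
  isgn ((p%:Z - 1) * (q%:Z - 1)) *: tpure (dinj q y) (dinj p x).

Definition rho : dsum C \ox dsum C -> dsum C \ox dsum C :=
  tlift (fun a b => dlift (fun p x => dlift (fun q y => @rho_hom p q x y) b) a).

Lemma rho_homDl p q (y : C q) : linear (fun x : C p => rho_hom x y).
Proof.
by move=> a x x'; rewrite /rho_hom linearP tpureDr tpureZr scalerDr !scalerA mulrC.
Qed.

Lemma rho_homDr p q (x : C p) : linear (fun y : C q => rho_hom x y).
Proof.
by move=> a y y'; rewrite /rho_hom linearP tpureDl tpureZl scalerDr !scalerA mulrC.
Qed.

Lemma rho_linear1 (b : dsum C) p :
  linear (fun x : C p => dlift (fun q y => @rho_hom p q x y) b).
Proof.
move=> a x x'; rewrite /dlift scaler_sumr -big_split; apply: eq_bigr => q _.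
by rewrite rho_homDl.
Qed.

Lemma rho_bilinear : bilinear_map
  (fun a b => dlift (fun p x => dlift (fun q y => @rho_hom p q x y) b) a).
Proof.
split=> [b|a c b b']; first exact: dlift_linear (rho_linear1 b).
rewrite -[LHS]/(\sum_(p < dbound a)
  dlift (fun q y => @rho_hom p q (a p) y) (c *: b + b')).
under eq_bigr do rewrite (dlift_linear (fun q => @rho_homDr _ q _)).
by rewrite big_split -scaler_sumr.
Qed.

HB.instance Definition _ := GRing.isLinear.Build k _ _ _ rho
  (tlift_linear rho_bilinear).

Lemma rhoE p q (x : C p) (y : C q) :
  rho (tpure (dinj p x) (dinj q y)) =
  isgn ((p%:Z - 1) * (q%:Z - 1)) *: tpure (dinj q y) (dinj p x).
Proof.
rewrite /rho (tlift_pure rho_bilinear) (dlift_inj (rho_linear1 _)).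
by rewrite (dlift_inj (fun q => @rho_homDr p q x)).
Qed.

End Cooperad.

Arguments cobrace {k C} _.
Arguments rho {k C} _.

(* Main.v *)
(** [([-] (x) id) o [-]] is a signed sum of the maps
    [(Delta_{p,q,i} (x) id) o Delta_{p+q-1,r,j}].  By the second coassociativity
    axiom the terms with [i <= j < i + q] are, with the same signs, the terms of
    [(id (x) [-]) o [-]], so they cancel.  On the remaining terms the first and
    third axioms give an involution exchanging the last two tensor factors, and
    the signs of two matched terms differ by [(-1)^((q-1)(r-1))], which is the
    sign in [rho]. *)
From HB Require Import structures.
Require Import Defs.
From mathcomp Require Import all_boot all_order all_algebra.
From mathcomp Require Import zify ring.

Set Implicit Arguments.
Unset Strict Implicit.
Unset Printing Implicit Defensive.

Import GRing.Theory.
Local Open Scope ring_scope.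

(** [h] and [h'] are mutually inverse between two duplicate-free lists, so [r] is a permutation of
    [map h s]. *)
Lemma big_seq_reindex (R : nmodType) (I J : eqType) (r : seq I) (s : seq J)
    (h : J -> I) (h' : I -> J) (F : I -> R) :
  uniq r -> uniq s ->
  {in s, forall j, h j \in r /\ h' (h j) = j} ->
  {in r, forall i, h' i \in s /\ h (h' i) = i} ->
  \sum_(i <- r) F i = \sum_(j <- s) F (h j).
Proof.
move=> ur us hs hr; rewrite -(big_map h xpredT F); apply: perm_big.
apply: uniq_perm => // [|i].
  by rewrite map_inj_in_uniq // => a b /hs[_ {2}<-] /hs[_ {2}<-] ->.
by apply/idP/mapP => [/hr[h1 h2]|[j /hs[h1 _] ->]//]; exists (h' i).
Qed.

(** * Tensor products and parity of signs *)

Section TensorFacts.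
Variable k : comPzRingType.

Lemma tens_ind (M N : lmodType k) (P : M \ox N -> Prop) :
  P 0 -> (forall x y, P x -> P y -> P (x + y)) ->
  (forall m n, P (tpure m n)) -> forall x, P x.
Proof.
move=> P0 PD Pp x; rewrite [x]tens_sum.
by elim/big_ind: _ => // mn _; exact: Pp.
Qed.

Lemma tpure0l (M N : lmodType k) (n : N) : tpure 0 n = 0 :> M \ox N.
Proof. by rewrite -(scale0r 0) tpureZl scale0r. Qed.

Lemma tpure0r (M N : lmodType k) (m : M) : tpure m 0 = 0 :> M \ox N.
Proof. by rewrite -(scale0r 0) tpureZr scale0r. Qed.

Lemma tpure_suml (M N : lmodType k) I (r : seq I) (F : I -> M) (n : N) :
  tpure (\sum_(i <- r) F i) n = \sum_(i <- r) tpure (F i) n.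
Proof.
apply: (big_morph (fun m => tpure m n)) => [m m'|]; first exact: tpureDl.
exact: tpure0l.
Qed.

Lemma tpure_sumr (M N : lmodType k) I (r : seq I) (m : M) (F : I -> N) :
  tpure m (\sum_(i <- r) F i) = \sum_(i <- r) tpure m (F i).
Proof.
apply: (big_morph (tpure m)) => [n n'|]; first exact: tpureDr.
exact: tpure0r.
Qed.

(** The sign depends only on the parity of the exponent, and the absolute value, though not
    additive, preserves parity. *)
Lemma isgnD (a b : int) : isgn k (a + b) = isgn k a * isgn k b.
Proof.
by rewrite /isgn -exprD -signr_odd -[RHS]signr_odd; congr (_ ^+ _); lia.
Qed.

Lemma isgn_double (a : int) : isgn k (a + a) = 1.
Proof. by rewrite /isgn -signr_odd; have -> : odd `|a + a| = false by lia. Qed.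

(** Reduces an equality of signs to an integer identity that [ring] can prove once [c] is
    supplied. *)
Lemma isgn_eq (c a b : int) : a = b + (c + c) -> isgn k a = isgn k b.
Proof. by move->; rewrite isgnD isgn_double mulr1. Qed.

End TensorFacts.

(** * Index sets of single and iterated decompositions *)

Section IndexPairs.
Local Open Scope nat_scope.

Definition dec_index n : seq (nat * nat) :=
  [seq (p, i) | p <- index_iota 1 n.+2, i <- index_iota 1 p.+1].

Lemma mem_dec_index n p i :
  ((p, i) \in dec_index n) = [&& 1 <= i, i <= p & p <= n.+1].
Proof.
apply/allpairsPdep/idP => [[p' [i' []]]|h].
  by rewrite !mem_index_iota => h h' [-> ->]; lia.
by exists p, i; rewrite !mem_index_iota; split=> //; lia.
Qed.

Lemma dec_index_uniq n : uniq (dec_index n).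
Proof.
apply: allpairs_uniq_dep => [|p _|[p i] [p' i'] _ _ [-> ->]] //; exact: iota_uniq.
Qed.

(** [f] gives the arity of the factor decomposed next: [id] for the left factor, [n + 1 - p] for the
    right one. *)
Definition dec_index2 (f : nat -> nat) n : seq ((nat * nat) * (nat * nat)) :=
  [seq (a, b) | a <- dec_index n, b <- dec_index (f a.1)].

Lemma mem_dec_index2 f n a b :
  ((a, b) \in dec_index2 f n) = (a \in dec_index n) && (b \in dec_index (f a.1)).
Proof.
apply/allpairsPdep/andP => [[a' [b' [ha hb [-> ->]]]] //|[ha hb]].
by exists a, b.
Qed.

Lemma dec_index2_uniq f n : uniq (dec_index2 f n).
Proof.
apply: allpairs_uniq_dep => [|a _|[a b] [a' b'] _ _ [-> ->]] //;
  exact: dec_index_uniq.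
Qed.

End IndexPairs.

(** * The iterated cobrace inside the tensor cube *)

Section Cobrace.
Variables (k : comPzRingType) (C : planar_counital_cooperad k).

Definition dinj3 p q r : C p \ox (C q \ox C r) -> dsum C \ox (dsum C \ox dsum C) :=
  tmap (dinj p) (tmap (dinj q) (dinj r)).

HB.instance Definition _ p q r := GRing.Linear.on (@dinj3 p q r).

Lemma dinj3_rho p q r (y : C p \ox (C q \ox C r)) :
  tmap idfun rho (dinj3 y)
  = isgn k ((q%:Z - 1) * (r%:Z - 1)) *: dinj3 (tmap idfun tswap y).
Proof.
elim/tens_ind: y => [|y z hy hz|a b]; first by rewrite !linear0.
  by rewrite !linearD /= hy hz.
rewrite /dinj3 !tmap_pure /= -tpureZr; congr tpure.
elim/tens_ind: b => [|y z hy hz|b c]; first by rewrite !linear0.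
  by rewrite !linearD /= hy hz.
by rewrite tswap_pure !tmap_pure rhoE.
Qed.

Lemma cobrace_homE n (x : C n) : cobrace_hom x =
  \sum_(a <- dec_index n) isgn k ((n%:Z - a.1%:Z) * (a.1%:Z - a.2%:Z)) *:
     tmap (dinj a.1) (dinj (n + 1 - a.1)%N) (cop_dec C n a.1 (n + 1 - a.1)%N a.2 x).
Proof. by rewrite big_allpairs_dep. Qed.

Lemma cobrace_left m r (y : C m \ox C r) :
  tassoc (tmap cobrace idfun (tmap (dinj m) (dinj r) y)) =
  \sum_(b <- dec_index m) isgn k ((m%:Z - b.1%:Z) * (b.1%:Z - b.2%:Z)) *:
    dinj3 (tassoc (tmap (cop_dec C m b.1 (m + 1 - b.1)%N b.2) idfun y)).
Proof.
elim/tens_ind: y => [|y z hy hz|u v].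
- by rewrite !linear0 big1 // => b _; rewrite !linear0.
- rewrite !linearD /= hy hz -big_split; apply: eq_bigr => b _.
  by rewrite !linearD /=.
rewrite !tmap_pure /= cobraceE cobrace_homE tpure_suml linear_sum.
apply: eq_bigr => -[p i] _ /=; rewrite tpureZl linearZ !tmap_pure /=.
congr (_ *: _); elim/tens_ind: (cop_dec _ _ _ _ _ _) => [|y z hy hz|a b].
- by rewrite linear0 !tpure0l !linear0.
- by rewrite linearD !tpureDl !linearD /= hy hz.
by rewrite tmap_pure !tassoc_pure /dinj3 !tmap_pure /= tmap_pure.
Qed.

Lemma cobrace_right p s (y : C p \ox C s) :
  tmap idfun cobrace (tmap (dinj p) (dinj s) y) =
  \sum_(b <- dec_index s) isgn k ((s%:Z - b.1%:Z) * (b.1%:Z - b.2%:Z)) *: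
    dinj3 (tmap idfun (cop_dec C s b.1 (s + 1 - b.1)%N b.2) y).
Proof.
elim/tens_ind: y => [|y z hy hz|u v].
- by rewrite !linear0 big1 // => b _; rewrite !linear0.
- rewrite !linearD /= hy hz -big_split; apply: eq_bigr => b _.
  by rewrite !linearD /=.
rewrite !tmap_pure /= cobraceE cobrace_homE tpure_sumr.
by apply: eq_bigr => -[q j] _ /=; rewrite tpureZr /dinj3 !tmap_pure.
Qed.

(** * Cancellation and symmetry on a homogeneous element *)

Section Homogeneous.
Variables (n : nat) (x : C n).

(* [m] and [s] are kept as independent indices, and everything is embedded in
   the tensor cube of the direct sum, so that arities can be rewritten freely. *)
Definition dec_left m p q r i j :=
  dinj3 (tassoc (tmap (cop_dec C m p q i) idfun (cop_dec C n m r j x))).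

Definition dec_right s p q r i j :=
  dinj3 (tmap idfun (cop_dec C s q r j) (cop_dec C n p s i x)).

(** Slot [i + j - 1] is the [j]-th in the block of [q] slots starting at [i], so the middle case of
    [cop_coassoc] applies. *)
Lemma dec_left_mid m s p q r i j :
  (1 <= i <= p)%N -> (1 <= j <= q)%N ->
  (m.+1 = p + q)%N -> (s.+1 = q + r)%N -> (n.+1 = m + r)%N ->
  dec_left m p q r i (i + j - 1) = dec_right s p q r i j.
Proof.
move=> hi hj hm hs hn; rewrite /dec_left /dec_right.
have -> : m = (p + q).-1 by lia.
rewrite cop_coassoc; [|lia..].
rewrite ifF; last lia.
rewrite ifT; last lia.
have -> : s = (q + r).-1 by lia.
by have -> : (i + j - 1 - i + 1 = j)%N by lia.
Qed.

Lemma dec_left_lt m m' p q r i j :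
  (1 <= i <= p)%N -> (i + q <= j <= m)%N ->
  (m.+1 = p + q)%N -> (m'.+1 = p + r)%N -> (n.+1 = m + r)%N ->
  dec_left m p q r i j =
  isgn k ((r%:Z - 1) * (q%:Z - 1)) *:
    tmap idfun rho (dec_left m' p r q (j - q + 1) i).
Proof.
move=> hi hj hm hm' hn; rewrite /dec_left dinj3_rho scalerA -isgnD.
(* The sign in the statement repeats the one produced by [rho], so their product is 1. *)
rewrite isgn_double scale1r.
have -> : m = (p + q).-1 by lia.
rewrite cop_coassoc; [|lia..].
rewrite ifT; last lia.
by have -> : m' = (p + r).-1 by lia.
Qed.

Lemma dec_left_gt m m' p q r i j :
  (1 <= j < i)%N -> (i <= p)%N ->
  (m.+1 = p + q)%N -> (m'.+1 = p + r)%N -> (n.+1 = m + r)%N ->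
  dec_left m p q r i j =
  isgn k ((r%:Z - 1) * (q%:Z - 1)) *:
    tmap idfun rho (dec_left m' p r q j (i + r - 1)).
Proof.
move=> hj hi hm hm' hn; rewrite /dec_left dinj3_rho scalerA -isgnD.
rewrite isgn_double scale1r.
have -> : m = (p + q).-1 by lia.
rewrite cop_coassoc; [|lia..].
rewrite ifF; last lia.
rewrite ifF; last lia.
by have -> : m' = (p + r).-1 by lia.
Qed.

(* The index [((m, j), (p, i))] stands for the term
   [(Delta_{p,q,i} (x) id) o Delta_{m,r,j}], with [q = m+1-p] and [r = n+1-m]. *)
Definition left_term (t : (nat * nat) * (nat * nat)) :=
  let: ((m, j), (p, i)) := t in
  isgn k ((n%:Z - m%:Z) * (m%:Z - j%:Z) + (m%:Z - p%:Z) * (p%:Z - i%:Z)) *: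
    dec_left m p (m + 1 - p) (n + 1 - m) i j.

(* The index [((p, i), (q, j))] stands for the term
   [(id (x) Delta_{q,r,j}) o Delta_{p,s,i}], with [s = n+1-p] and [r = s+1-q]. *)
Definition right_term (t : (nat * nat) * (nat * nat)) :=
  let: ((p, i), (q, j)) := t in
  isgn k ((n%:Z - p%:Z) * (p%:Z - i%:Z)
          + ((n + 1 - p)%N%:Z - q%:Z) * (q%:Z - j%:Z)) *:
    dec_right (n + 1 - p) p q (n + 1 - p + 1 - q) i j.

Lemma left_sum : tassoc (tmap cobrace idfun (cobrace_hom x))
  = \sum_(t <- dec_index2 id n) left_term t.
Proof.
rewrite cobrace_homE [tmap _ _ _]linear_sum linear_sum [RHS]big_allpairs_dep.
apply: eq_bigr => -[m j] _; rewrite linearZ /= linearZ /= cobrace_left scaler_sumr.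
by apply: eq_bigr => -[p i] _; rewrite /= scalerA -isgnD.
Qed.

Lemma right_sum : tmap idfun cobrace (cobrace_hom x)
  = \sum_(t <- dec_index2 (fun p => n + 1 - p)%N n) right_term t.
Proof.
rewrite cobrace_homE linear_sum [RHS]big_allpairs_dep.
apply: eq_bigr => -[p i] _; rewrite linearZ /= cobrace_right scaler_sumr.
by apply: eq_bigr => -[q j] _; rewrite /= scalerA -isgnD.
Qed.

(** Selects the middle case of [cop_coassoc], where slot [j] lies in the block of [q = m + 1 - p]
    slots starting at [i]. *)
Definition nested (t : (nat * nat) * (nat * nat)) : bool :=
  let: ((m, j), (p, i)) := t in (i <= j < i + (m + 1 - p))%N.

Lemma nested_sum :
  \sum_(t <- dec_index2 id n | nested t) left_term t
  = \sum_(t <- dec_index2 (fun p => n + 1 - p)%N n) right_term t.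
Proof.
(* The index change of [dec_left_mid], with [m = p + q - 1], and its inverse. *)
pose h (t : (nat * nat) * (nat * nat)) :=
  let: ((p, i), (q, j)) := t in ((p + q - 1, i + j - 1), (p, i))%N.
pose h' (t : (nat * nat) * (nat * nat)) :=
  let: ((m, j), (p, i)) := t in ((p, i), (m + 1 - p, j - i + 1))%N.
rewrite -big_filter (@big_seq_reindex _ _ _ _
  (dec_index2 (fun p => n + 1 - p)%N n) h h'); first last.
- move=> [[m j] [p i]]; rewrite mem_filter !mem_dec_index2 !mem_dec_index /=.
  by move=> hmem; split; [lia|congr (_, _, (_, _)); lia].
- move=> [[p i] [q j]]; rewrite mem_filter !mem_dec_index2 !mem_dec_index /=.
  by move=> hmem; split; [lia|congr (_, _, (_, _)); lia].
- exact: dec_index2_uniq.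
- exact/filter_uniq/dec_index2_uniq.
apply: eq_big_seq => -[[p i] [q j]]; rewrite !mem_dec_index2 !mem_dec_index /=.
move=> hmem; rewrite (@dec_left_mid _ (n + 1 - p)); [|lia..].
have -> : (p + q - 1 + 1 - p = q)%N by lia.
have -> : (n + 1 - (p + q - 1) = n + 1 - p + 1 - q)%N by lia.
congr (isgn _ _ *: _).
(* The two exponents agree as integers, not merely modulo 2; [ring] sees this once truncated
   subtractions are removed. *)
have -> : (n + 1 - p)%N%:Z = n%:Z + 1 - p%:Z by lia.
have -> : (p + q - 1)%N%:Z = p%:Z + q%:Z - 1 by lia.
have -> : (i + j - 1)%N%:Z = i%:Z + j%:Z - 1 by lia.
ring.
Qed.

(** Swaps [q] and [r]. On non-nested indices it interchanges the cases where [j] lies after and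
    before the block at [i], hence is an involution there. *)
Definition exchange (t : (nat * nat) * (nat * nat)) :=
  let: ((m, j), (p, i)) := t in
  let q := (m + 1 - p)%N in let r := (n + 1 - m)%N in
  if (i + q <= j)%N then ((p + r - 1, i), (p, j - q + 1))%N
  else ((p + r - 1, i + r - 1), (p, j))%N.

Lemma exchange_mem t : t \in [seq t <- dec_index2 id n | ~~ nested t] ->
  exchange t \in [seq t <- dec_index2 id n | ~~ nested t]
  /\ exchange (exchange t) = t.
Proof.
case: t => [[m j] [p i]]; rewrite mem_filter !mem_dec_index2 !mem_dec_index => hmem.
rewrite /= in hmem; rewrite {1 3}/exchange; case: ifP => hij;
  rewrite mem_filter mem_dec_index2 !mem_dec_index /=.
  split; first lia.
  by rewrite ifF; [congr (_, _, (_, _)); lia|lia].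
split; first lia.
by rewrite ifT; [congr (_, _, (_, _)); lia|lia].
Qed.

Lemma left_term_exchange t : t \in [seq t <- dec_index2 id n | ~~ nested t] ->
  left_term t = tmap idfun rho (left_term (exchange t)).
Proof.
case: t => [[m j] [p i]]; rewrite mem_filter !mem_dec_index2 !mem_dec_index /=.
set q := (m + 1 - p)%N; set r := (n + 1 - m)%N => hmem.
have eq1 : (p + r - 1 + 1 - p = r)%N by lia.
have eq2 : (n + 1 - (p + r - 1) = q)%N by lia.
have Em : m%:Z = p%:Z + q%:Z - 1 by lia.
have En : n%:Z = p%:Z + q%:Z + r%:Z - 2 by lia.
have Em' : (p + r - 1)%N%:Z = p%:Z + r%:Z - 1 by lia.
case: ifP => hij; rewrite [in RHS]linearZ /= eq1 eq2.
  rewrite (@dec_left_lt m (p + r - 1)); [|lia..].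
  rewrite scalerA -isgnD; congr (_ *: _).
  have Ej : (j - q + 1)%N%:Z = j%:Z - q%:Z + 1 by lia.
  rewrite Em' Ej En Em.
  by congr isgn; ring.
rewrite (@dec_left_gt m (p + r - 1)); [|lia..].
rewrite scalerA -isgnD; congr (_ *: _).
have Ei : (i + r - 1)%N%:Z = i%:Z + r%:Z - 1 by lia.
rewrite Em' Ei En Em.
(* Here the exponents differ by twice [(q - 1) * (r - 1)], whereas in the previous case they
   coincide. *)
by apply: (@isgn_eq _ ((q%:Z - 1) * (r%:Z - 1))); ring.
Qed.

Lemma unnested_sum :
  \sum_(t <- dec_index2 id n | ~~ nested t) left_term t
  = tmap idfun rho (\sum_(t <- dec_index2 id n | ~~ nested t) left_term t).
Proof.
rewrite -big_filter linear_sum.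
(* Reindexing only the right-hand side by [exchange] lets the terms be matched one by one. *)
rewrite [RHS](@big_seq_reindex _ _ _ _ _ exchange exchange _
  (filter_uniq _ (dec_index2_uniq _ _)) (filter_uniq _ (dec_index2_uniq _ _))
  exchange_mem exchange_mem).
exact: eq_big_seq left_term_exchange.
Qed.

Lemma pre_coJacobi_hom :
  let J := tassoc (tmap cobrace idfun (cobrace_hom x))
           - tmap idfun cobrace (cobrace_hom x) in
  J = tmap idfun rho J.
Proof.
(* The nested terms cancel against the right sum, leaving the non-nested ones. *)
rewrite /= left_sum right_sum (bigID nested) /= nested_sum addrC addrK.
exact: unnested_sum.
Qed.

End Homogeneous.

End Cobrace.

Theorem proposition2p6 (k : comPzRingType) (C : planar_counital_cooperad k)
    (x : dsum C) :
  tassoc (tmap cobrace idfun (cobrace x)) - tmap idfun cobrace (cobrace x)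
  = tmap idfun rho
      (tassoc (tmap cobrace idfun (cobrace x)) - tmap idfun cobrace (cobrace x)).
Proof.
(* By linearity it suffices to treat each homogeneous component of [x]. *)
rewrite [x]dsum_sum [cobrace _]linear_sum [tmap cobrace _ _]linear_sum.
rewrite [tmap _ cobrace _]linear_sum [tassoc _]linear_sum -sumrB linear_sum.
by apply: eq_bigr => n _; rewrite /= cobraceE; exact: pre_coJacobi_hom.
Qed.
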